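(* Let $T=C$ (the Cesàro operator) or $T=C^*$ (the Copson operator). Let $X$ and $Y$ be Banach function spaces on $[0,1]$ such that $L^\infty[0,1]\hookrightarrow Y\hookrightarrow X$, let $0<a<b<1$, and define the Banach function space $Z=Z[0,1]$ by $$Z[0,1]:=X|_{[0,a]}\oplus Y|_{[a,b]}\oplus X|_{[b,1]}.$$ Then $TZ[0,1]=TX[0,1]$, i.e. these spaces have the same elements and equivalent norms.
   Context: $L^0[0,1]$ is the space of (a.e. equivalence classes of) real-valued Lebesgue measurable functions on $[0,1]$. A Banach function space $X$ on $[0,1]$ is a Banach space that is a linear subspace of $L^0[0,1]$ with the ideal property: $|f|\le|g|$ a.e., $f\in L^0[0,1]$, $g\in X$ imply $f\in X$ and $\|f\|_X\le\|g\|_X$; by convention $X$ also contains a function positive a.e. $X\hookrightarrow Y$ means $X\subset Y$ with continuous inclusion. For $A\subset[0,1]$, $X|_A=\{f\in X:\operatorname{supp}(f)\subset A\}$ with the norm of $X$. Thus $Z$ consists of all $f\in L^0[0,1]$ with $f\chi_{[0,a]}\in X$, $f\chi_{[a,b]}\in Y$, $f\chi_{[b,1]}\in X$, with norm (up to equivalence) $\|f\chi_{[0,a]}\|_X+\|f\chi_{[a,b]}\|_Y+\|f\chi_{[b,1]}\|_X$. Cesàro operator: $Cf(x)=\frac1x\int_0^x f(t)\,dt$ for $0<x\le1$. Copson operator: $C^*f(x)=\int_x^1\frac{f(t)}{t}\,dt$ for $x\in[0,1]$. $TX=\{f\in L^0[0,1]: T|f|\in X\}$ with norm $\|f\|_{TX}=\|T|f|\|_X$.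 *)

(* Defs.v *)
From HB Require Import structures.
From mathcomp Require Import all_boot all_order all_algebra.
From mathcomp Require Import all_classical all_reals all_analysis measurable_realfun.
From mathcomp Require Import ring.
Set Implicit Arguments.
Unset Strict Implicit.
Unset Printing Implicit Defensive.
Import Order.TTheory GRing.Theory Num.Theory.
Import numFieldNormedType.Exports.
Local Open Scope classical_set_scope.
Local Open Scope ring_scope.

(* The real line with the sigma-algebra of all Lebesgue measurable sets, the
   domain of completed_lebesgue_measure. *)
Definition lebR (R : realType) :=
  caratheodory_type (wlength (@idfun R : cumulative R R))^*%mu.

Notation lebm := completed_lebesgue_measure.

(* An element of L^0[0,1], which is a class modulo a.e. equality on [0,1], is
   given by any representative R -> R; values outside [0,1] are irrelevant. *)
Definition L0 (R : realType) : set (R -> R) :=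
  [set f | measurable_fun (`[0, 1] : set (lebR R)) (f : lebR R -> R)].

Definition ae01 (R : realType) (P : R -> Prop) : Prop :=
  {ae lebm, forall x : lebR R, (x : R) \in `[0, 1] -> P x}.

(* fnorm is only meaningful on the carrier. *)
Record fspace (R : realType) := FSpace {
  carrier : set (R -> R);
  fnorm : (R -> R) -> R }.

(* Equality in L^0 being a.e. equality, bfs_ideal contains the compatibility
   of the carrier and of the norm with the choice of representatives. *)
Record is_bfs (R : realType) (X : fspace R) : Prop := {
  bfs_L0 : carrier X `<=` @L0 R;
  bfs_0 : carrier X (cst 0);
  bfs_add : forall f g, carrier X f -> carrier X g -> carrier X (f \+ g);
  bfs_scale : forall c f, carrier X f -> carrier X (cst c \* f);
  bfs_norm_ge0 : forall f, carrier X f -> 0 <= fnorm X f;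
  bfs_norm_eq0 : forall f, carrier X f -> fnorm X f = 0 -> ae01 (fun x => f x = 0);
  bfs_norm_scale : forall c f, carrier X f ->
    fnorm X (cst c \* f) = `|c| * fnorm X f;
  bfs_norm_add : forall f g, carrier X f -> carrier X g ->
    fnorm X (f \+ g) <= fnorm X f + fnorm X g;
  bfs_complete : forall u : nat -> R -> R, (forall n, carrier X (u n)) ->
    (forall e, 0 < e -> exists N, forall m n, (N <= m)%N -> (N <= n)%N ->
      fnorm X (u m \- u n) < e) ->
    exists2 f, carrier X f & fnorm X (u n \- f) @[n --> \oo] --> (0 : R);
  bfs_ideal : forall f g, L0 f -> carrier X g ->
    ae01 (fun x => `|f x| <= `|g x|) ->
    carrier X f /\ fnorm X f <= fnorm X g;
  bfs_pos : exists2 w, carrier X w & ae01 (fun x => 0 < w x) }.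

Definition embeds (R : realType) (X Y : fspace R) : Prop :=
  carrier X `<=` carrier Y /\
  forall f, carrier X f -> forall e, 0 < e -> exists2 d, 0 < d &
    forall g, carrier X g -> fnorm X (g \- f) < d -> fnorm Y (g \- f) < e.

(* Same elements and equivalent norms. *)
Definition equal_equiv (R : realType) (X Y : fspace R) : Prop :=
  carrier X = carrier Y /\
  exists c C, [/\ 0 < c, 0 < C & forall f, carrier X f ->
    c * fnorm Y f <= fnorm X f <= C * fnorm Y f].

Definition Linf_norm (R : realType) (f : R -> R) : \bar R :=
  'N[lebm]_+oo[(fun x : lebR R => (f x * \1_(`[0, 1]) x)%:E)]%E.

Definition Linf (R : realType) : fspace R := {|
  carrier := [set f | L0 f /\ (Linf_norm f < +oo)%E];
  fnorm f := fine (Linf_norm f) |}.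

(* X|_[0,a] (+) Y|_[a,b] (+) X|_[b,1]; that it is a Banach function space is
   splice_is_bfs below. *)
Definition splice (R : realType) (X Y : fspace R) (a b : R) : fspace R := {|
  carrier := [set f | [/\ L0 f, carrier X (f \* \1_(`[0, a])),
    carrier Y (f \* \1_(`[a, b])) & carrier X (f \* \1_(`[b, 1]))]];
  fnorm f := fnorm X (f \* \1_(`[0, a])) + fnorm Y (f \* \1_(`[a, b])) +
    fnorm X (f \* \1_(`[b, 1])) |}.

Definition Cesaro_op (R : realType) (f : R -> R) (x : R) : \bar R :=
  ((x^-1)%:E * \int[lebm]_(t in (`[0%R, x] : set (lebR R))) (f t)%:E)%E.

Definition Copson_op (R : realType) (f : R -> R) (x : R) : \bar R :=
  (\int[lebm]_(t in (`[x, 1%R] : set (lebR R))) (f t / t)%:E)%E.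

(* T|f| may be infinite; T|f| in X means that T|f| is finite a.e. and that the
   real function it defines a.e. belongs to X. *)
Definition opspace (R : realType) (T : (R -> R) -> R -> \bar R) (X : fspace R) :
  fspace R :=
  let Tabs f := T (fun t => `|f t|) in {|
  carrier := [set f | [/\ L0 f, ae01 (fun x => Tabs f x \is a fin_num) &
    carrier X (fine \o Tabs f)]];
  fnorm f := fnorm X (fine \o Tabs f) |}.

Lemma measurable_lebR (R : realType) (A : set R) :
  measurable A -> measurable (A : set (lebR R)).
Proof.
move=> mA; have := @sub_caratheodory _ _ _ (wlength (@idfun R : cumulative R R)) A.
by apply; exact: mA.
Qed.

Lemma L0_add (R : realType) (f g : R -> R) : L0 f -> L0 g -> L0 (f \+ g).
Proof. by move=> mf mg; exact: measurable_funD. Qed.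

Lemma L0_indic (R : realType) (f : R -> R) u v :
  L0 f -> L0 (f \* \1_(`[u, v])).
Proof.
move=> mf; apply: measurable_funM => //.
apply: measurable_funTS; apply: measurable_indic.
by apply: measurable_lebR; exact: measurable_itv.
Qed.

Lemma ae01W (R : realType) (P : R -> Prop) : (forall x, P x) -> ae01 P.
Proof. by move=> h; apply: aeW => x _; exact: h. Qed.

Lemma ae01S (R : realType) (P Q : R -> Prop) :
  (forall x, 0 <= x <= 1 -> P x -> Q x) -> ae01 P -> ae01 Q.
Proof.
rewrite /ae01 => PQ; apply: filterS => x Px x01; apply: PQ; last exact: Px.
by move: x01; rewrite in_itv.
Qed.

Lemma ae01I (R : realType) (P Q : R -> Prop) :
  ae01 P -> ae01 Q -> ae01 (fun x => P x /\ Q x).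
Proof. by rewrite /ae01 => p q; apply: filterS2 p q => x Px Qx h; split; auto. Qed.

Lemma ae01_neq (R : realType) (a : R) : ae01 (fun x => x != a).
Proof.
exists [set a]; split.
- by apply: measurable_lebR; exact: measurable_set1.
- exact: (@lebesgue_measure_set1 R a).
- move=> x /= nx; apply/eqP; apply/negPn/negP => xa; exact: nx.
Qed.

Lemma indic_itv (R : realType) (u v x : R) :
  \1_(`[u, v]) x = (u <= x <= v)%R%:R :> R.
Proof. by rewrite indicE mem_setE in_itv. Qed.

Section bfs_facts.
Context (R : realType) (X : fspace R) (hX : is_bfs X).
Implicit Types (f g : R -> R) (u v : R).

Lemma bfs_eq f g : L0 f -> carrier X g -> ae01 (fun x => f x = g x) ->
  carrier X f /\ fnorm X f = fnorm X g.
Proof.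
move=> Lf Xg fg.
have [Xf le1] := bfs_ideal hX Lf Xg (ae01S (fun x _ e => eq_ind_r (fun t => `|t| <= _) (lexx _) e) fg).
split => //; apply/eqP; rewrite eq_le le1 /=.
apply: (bfs_ideal hX (bfs_L0 hX Xg) Xf _).2.
by apply: ae01S fg => x _ ->.
Qed.

Lemma bfs_indic f u v : carrier X f ->
  carrier X (f \* \1_(`[u, v])) /\ fnorm X (f \* \1_(`[u, v])) <= fnorm X f.
Proof.
move=> Xf; apply: (bfs_ideal hX) => //.
  exact/L0_indic/(bfs_L0 hX).
apply: ae01W => x /=; rewrite indic_itv normrM.
by case: (_ <= _ <= _); rewrite ?normr1 ?mulr1 // normr0 mulr0.
Qed.

Lemma bfs_sub f g : carrier X f -> carrier X g -> carrier X (f \- g).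
Proof.
move=> Xf Xg; have -> : f \- g = f \+ (cst (-1) \* g).
  by apply/funext => x /=; rewrite mulN1r.
by apply: (bfs_add hX) => //; exact: bfs_scale.
Qed.

Lemma bfs_complete_indic (w : nat -> R -> R) u v :
  (forall n, carrier X (w n \* \1_(`[u, v]))) ->
  (forall e, 0 < e -> exists N, forall m n, (N <= m)%N -> (N <= n)%N ->
      fnorm X ((w m \- w n) \* \1_(`[u, v])) < e) ->
  exists2 f, carrier X f &
    fnorm X ((w n \- f) \* \1_(`[u, v])) @[n --> \oo] --> (0 : R).
Proof.
move=> Xw Cw.
have E m n : (w m \- w n) \* \1_(`[u, v]) =
    (w m \* \1_(`[u, v])) \- (w n \* \1_(`[u, v])) :> (R -> R).
  by apply/funext => x /=; rewrite mulrBl.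
have [|f Xf cf] := bfs_complete hX Xw.
  by move=> e /Cw[N NC]; exists N => m n Nm Nn; rewrite -E; exact: NC.
exists f => //.
have E' n : (w n \- f) \* \1_(`[u, v]) =
    ((w n \* \1_(`[u, v])) \- f) \* \1_(`[u, v]) :> (R -> R).
  apply/funext => x /=; rewrite !mulrBl indic_itv; congr (_ - _).
  by case: (_ <= _ <= _); rewrite ?mulr1 ?mulr0.
apply: (squeeze_cvgr _ (cvg_cst 0) cf); apply: nearW => n.
rewrite E'; have [h1 h2] := bfs_indic u v (bfs_sub (Xw n) Xf).
by rewrite (bfs_norm_ge0 hX h1).
Qed.

End bfs_facts.

Lemma splice_is_bfs (R : realType) (X Y : fspace R) (a b : R) :
  is_bfs X -> is_bfs Y -> 0 < a -> a < b -> b < 1 -> is_bfs (splice X Y a b).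
Proof.
move=> hX hY a0 ab b1.
pose ch u v : R -> R := \1_(`[u, v]).
have addE u v (f g : R -> R) : (f \+ g) \* ch u v = (f \* ch u v) \+ (g \* ch u v).
  by apply/funext => x /=; rewrite mulrDl.
have scaleE u v (c : R) (f : R -> R) : (cst c \* f) \* ch u v = cst c \* (f \* ch u v).
  by apply/funext => x /=; rewrite mulrA.
have spliceP (g1 g2 g3 : R -> R) : carrier X g1 -> carrier Y g2 -> carrier X g3 ->
    let f := (g1 \* ch 0 a) \+ (g2 \* ch a b) \+ (g3 \* ch b 1) in
    L0 f /\ ae01 (fun x => [/\ f x * ch 0 a x = g1 x * ch 0 a x,
      f x * ch a b x = g2 x * ch a b x, f x * ch b 1 x = g3 x * ch b 1 x &
      f x = if x <= a then g1 x else if x <= b then g2 x else g3 x]).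
  move=> X1 Y2 X3; split.
    apply: L0_add; first apply: L0_add; apply: L0_indic.
    - exact: bfs_L0 hX _ X1.
    - exact: bfs_L0 hY _ Y2.
    - exact: bfs_L0 hX _ X3.
  apply: ae01S (ae01I (ae01_neq a) (ae01_neq b)) => x /andP[x0 x1] [xa xb] /=.
  rewrite /ch !indic_itv x0 x1 /= andbT.
  have [hxa|hxa] : x < a \/ a < x by apply/orP; rewrite -neq_lt.
    have hxb := lt_trans hxa ab.
    rewrite (ltW hxa) (lt_geF hxa) (lt_geF hxb) /=.
    by split; ring.
  rewrite (ltW hxa) (lt_geF hxa) /=.
  have [hxb|hxb] : x < b \/ b < x by apply/orP; rewrite -neq_lt.
    rewrite (ltW hxb) (lt_geF hxb) /=.
    by split; ring.
  rewrite (ltW hxb) (lt_geF hxb) /=.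
  by split; ring.
have spliceZ (f : R -> R) : carrier (splice X Y a b) f ->
    [/\ L0 f, carrier X (f \* ch 0 a), carrier Y (f \* ch a b) & carrier X (f \* ch b 1)] by [].
have ch0 u v : (cst 0 : R -> R) \* ch u v = cst 0.
  by apply/funext => x /=; rewrite mul0r.
split.
- by move=> f [].
- split; rewrite -/(ch _ _) ?ch0; [exact: measurable_cst|exact: bfs_0 hX|exact: bfs_0 hY|exact: bfs_0 hX].
- move=> f g /spliceZ[? ? ? ?] /spliceZ[? ? ? ?]; split; rewrite -/(ch _ _) ?addE.
  + exact: L0_add.
  + exact: bfs_add hX _ _ _ _.
  + exact: bfs_add hY _ _ _ _.
  + exact: bfs_add hX _ _ _ _.
- move=> c f /spliceZ[Lf ? ? ?]; split; rewrite -/(ch _ _) ?scaleE.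
  + by apply: measurable_funM => //; exact: measurable_cst.
  + exact: bfs_scale hX _ _ _.
  + exact: bfs_scale hY _ _ _.
  + exact: bfs_scale hX _ _ _.
- by move=> f /spliceZ[_ ? ? ?]; rewrite /= !addr_ge0 // ?(bfs_norm_ge0 hX) ?(bfs_norm_ge0 hY).
- move=> f /spliceZ[_ h1 h2 h3] /= /eqP.
  have n1 := bfs_norm_ge0 hX h1; have n2 := bfs_norm_ge0 hY h2.
  have n3 := bfs_norm_ge0 hX h3.
  rewrite paddr_eq0 ?addr_ge0 // paddr_eq0 // => /andP[/andP[/eqP e1 /eqP e2] /eqP e3].
  move: (bfs_norm_eq0 hX h1 e1) (bfs_norm_eq0 hY h2 e2) (bfs_norm_eq0 hX h3 e3).
  move=> z1 z2 z3; apply: ae01S (ae01I z1 (ae01I z2 z3)) => x /andP[x0 x1] /=.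
  rewrite /ch !indic_itv x0 x1 /= andbT => -[].
  have [_|ax] := leP x a; first by rewrite mulr1.
  have [_|bx] := leP x b; rewrite ?(ltW ax) ?(ltW bx) /= ?mulr1 => _ [] //.
- move=> c f /spliceZ[_ h1 h2 h3] /=; rewrite -/(ch _ _) -/(ch _ _) -/(ch _ _) !scaleE.
  by rewrite !(bfs_norm_scale hX) // (bfs_norm_scale hY) // -!mulrDr.
- move=> f g /spliceZ[_ h1 h2 h3] /spliceZ[_ k1 k2 k3] /=.
  rewrite -/(ch _ _) -/(ch _ _) -/(ch _ _) !addE.
  apply: le_trans (lerD (lerD (bfs_norm_add hX h1 k1) (bfs_norm_add hY h2 k2)) (bfs_norm_add hX h3 k3)) _.
  by rewrite le_eqVlt; apply/orP; left; apply/eqP; ring.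
- move=> w Zw Cw.
  have subE u v (f g : R -> R) : (f \- g) \* ch u v = (f \* ch u v) \- (g \* ch u v).
    by apply/funext => x /=; rewrite mulrBl.
  have nn m n : [/\ 0 <= fnorm X ((w m \- w n) \* ch 0 a),
      0 <= fnorm Y ((w m \- w n) \* ch a b) &
      0 <= fnorm X ((w m \- w n) \* ch b 1)].
    have [_ ? ? ?] := spliceZ _ (Zw m); have [_ ? ? ?] := spliceZ _ (Zw n).
    by rewrite !subE; split; [apply: (bfs_norm_ge0 hX)|apply: (bfs_norm_ge0 hY)|
      apply: (bfs_norm_ge0 hX)]; apply: bfs_sub.
  have [|e /Cw[N NC]|g1 X1 c1] := bfs_complete_indic (w := w) (u := 0) (v := a) hX.
  + by move=> n; have [] := spliceZ _ (Zw n).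
  + exists N => m n Nm Nn; have := NC m n Nm Nn; have [? ? ?] := nn m n => /= h.
    by apply: le_lt_trans h; rewrite -addrA lerDl addr_ge0.
  have [|e /Cw[N NC]|g2 Y2 c2] := bfs_complete_indic (w := w) (u := a) (v := b) hY.
  + by move=> n; have [] := spliceZ _ (Zw n).
  + exists N => m n Nm Nn; have := NC m n Nm Nn; have [? ? ?] := nn m n => /= h.
    by apply: le_lt_trans h; rewrite addrAC lerDr addr_ge0.
  have [|e /Cw[N NC]|g3 X3 c3] := bfs_complete_indic (w := w) (u := b) (v := 1) hX.
  + by move=> n; have [] := spliceZ _ (Zw n).
  + exists N => m n Nm Nn; have := NC m n Nm Nn; have [? ? ?] := nn m n => /= h.
    by apply: le_lt_trans h; rewrite lerDr addr_ge0.
  have [Lf fE] := spliceP _ _ _ X1 Y2 X3; set f := (X in L0 X) in Lf fE.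
  have Zf : carrier (splice X Y a b) f.
    split => //.
    + apply: (bfs_eq hX _ (bfs_indic hX 0 a X1).1 _).1; first exact: L0_indic.
      by apply: ae01S fE => x _ [].
    + apply: (bfs_eq hY _ (bfs_indic hY a b Y2).1 _).1; first exact: L0_indic.
      by apply: ae01S fE => x _ [].
    + apply: (bfs_eq hX _ (bfs_indic hX b 1 X3).1 _).1; first exact: L0_indic.
      by apply: ae01S fE => x _ [].
  exists f => //.
  have key (W : fspace R) (hW : is_bfs W) u v g n :
      carrier W g -> carrier W (w n \* ch u v) -> L0 f ->
      ae01 (fun x => f x * ch u v x = g x * ch u v x) ->
      fnorm W ((w n \- f) \* ch u v) = fnorm W ((w n \- g) \* ch u v).
    move=> Wg Ww _ e.
    have Wgc := (bfs_indic hW u v Wg).1.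
    rewrite !subE; apply: (bfs_eq hW _ _ _).2.
    + apply: measurable_funB; first exact: bfs_L0 hW _ Ww.
      exact: L0_indic.
    + exact: bfs_sub.
    + by apply: ae01S e => x _ /= ->.
  rewrite -[0 : R]addr0 -[X in _ --> X + _]addr0.
  apply: cvg_trans (cvgD (cvgD c1 c2) c3); apply: near_eq_cvg; apply: nearW => n.
  have [_ ? ? ?] := spliceZ _ (Zw n); rewrite /=.
  have e1 : fnorm X ((w n \- f) \* ch 0 a) = fnorm X ((w n \- g1) \* ch 0 a).
    by apply: key => //; apply: ae01S fE => x _ [].
  have e2 : fnorm Y ((w n \- f) \* ch a b) = fnorm Y ((w n \- g2) \* ch a b).
    by apply: key => //; apply: ae01S fE => x _ [].
  have e3 : fnorm X ((w n \- f) \* ch b 1) = fnorm X ((w n \- g3) \* ch b 1).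
    by apply: key => //; apply: ae01S fE => x _ [].
  by rewrite -/(ch 0 a) -/(ch a b) -/(ch b 1) e1 e2 e3.
- move=> f g Lf /spliceZ[Lg h1 h2 h3] fg.
  have le u v : ae01 (fun x => `|(f \* ch u v) x| <= `|(g \* ch u v) x|).
    by apply: ae01S fg => x _ h /=; rewrite !normrM ler_wpM2r.
  have [? ?] := bfs_ideal hX (L0_indic 0 a Lf) h1 (le _ _).
  have [? ?] := bfs_ideal hY (L0_indic a b Lf) h2 (le _ _).
  have [? ?] := bfs_ideal hX (L0_indic b 1 Lf) h3 (le _ _).
  by split; [split|rewrite /= !lerD].
- have [w1 X1 p1] := bfs_pos hX; have [w2 Y2 p2] := bfs_pos hY.
  have [Lf fE] := spliceP _ _ _ X1 Y2 X1; set f := (X in L0 X) in Lf fE.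
  exists f; last first.
    apply: ae01S (ae01I fE (ae01I p1 p2)) => x _ [[_ _ _ E] [? ?]]; rewrite (E : f x = _).
    by case: ifP => // _; case: ifP.
  split => //.
  + apply: (bfs_eq hX _ (bfs_indic hX 0 a X1).1 _).1; first exact: L0_indic.
    by apply: ae01S fE => x _ [].
  + apply: (bfs_eq hY _ (bfs_indic hY a b Y2).1 _).1; first exact: L0_indic.
    by apply: ae01S fE => x _ [].
  + apply: (bfs_eq hX _ (bfs_indic hX b 1 X1).1 _).1; first exact: L0_indic.
    by apply: ae01S fE => x _ [].
Qed.

(* Main.v *)
Require Import Defs.
From mathcomp Require Import all_boot all_order all_algebra.
From mathcomp Require Import all_classical all_reals all_analysis.
From mathcomp Require Import ess_sup_inf lra.
Import Order.TTheory GRing.Theory Num.Theory.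
Import numFieldNormedType.Exports.
Local Open Scope classical_set_scope.
Local Open Scope ring_scope.

(** A function of the form T|f| can be controlled on the middle interval
[a, b] by its values on one of the outer intervals, so replacing the norm of
X by that of Y in the middle costs only a constant.

For the Cesàro operator, put m = \int_0^b |f|.  Then C|f| <= m / a on [a, b],
because there 1/x <= 1/a and the integral only grows with its upper limit;
and C|f| >= m on [b, 1], because there 1/x >= 1.  For the Copson operator,
C^*|f| is nonincreasing, so that m = C^*|f|(a) bounds it from above on [a, b]
and from below on [0, a].  In both cases (Cesaro_plateau, Copson_plateau)
there are an outer interval [u, v] and a constant c, independent of f, with
T|f| <= c m on [a, b] and m <= T|f| on [u, v].

If T|f| belongs to X, the lower bound gives m ||1_[u,v]||_X <= ||T|f|||_X, and
||1_[u,v]||_X is positive because [u, v] has positive measure.  The upper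
bound then puts T|f| 1_[a,b] in Y with norm at most
c (||1_[a,b]||_Y / ||1_[u,v]||_X) ||T|f|||_X (plateau_bound); the indicators lie
in Y and in X because L^oo embeds in Y and Y in X.  Hence TX is contained in TZ.
The converse inclusion already holds between Z and X (bfs_of_splice), since a
continuous inclusion of Y in X is bounded (embeds_bounded). *)

(** The integral of a nonnegative function is by definition a supremum over the
simple functions below it, so enlarging the domain enlarges the set whose
supremum is taken. *)
Lemma ge0_integral_le_subset d (T : measurableType d) (R : realType)
    (mu : {measure set T -> \bar R}) (A B : set T) (f : T -> \bar R) :
  (forall x, B x -> (0 <= f x)%E) -> A `<=` B ->
  (\int[mu]_(x in A) f x <= \int[mu]_(x in B) f x)%E.
Proof.
move=> f0 AB.
have fA0 x : (0 <= (f \_ A) x)%E.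
  by rewrite patchE; case: ifPn => // /set_mem/AB/f0.
have fB0 x : (0 <= (f \_ B) x)%E.
  by rewrite patchE; case: ifPn => // /set_mem/f0.
have fAB x : ((f \_ A) x <= (f \_ B) x)%E.
  rewrite [leLHS]patchE; case: ifPn => // /set_mem/AB Bx.
  by rewrite patchE mem_set.
rewrite integral_mkcond [leRHS]integral_mkcond !ge0_integralTE//.
by apply: ereal_sup_le => _ [h hA <-]; exists h => // x; exact: le_trans (fAB x).
Qed.

(** Continuity at 0 with e = 1 gives a radius d; if ||f||_Y exceeded ||f||_X / d,
then f / ||f||_Y would lie in the ball of radius d of X while having norm 1
in Y. *)
Lemma embeds_bounded (R : realType) (X Y : fspace R) :
  is_bfs X -> is_bfs Y -> embeds X Y ->
  exists2 K, 0 < K & forall f, carrier X f -> fnorm Y f <= K * fnorm X f.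
Proof.
move=> hX hY [sXY cXY]; have sub0 (g : R -> R) : g \- cst 0 = g.
  by apply/funext => x /=; rewrite subr0.
have [d d0 hd] := cXY _ (bfs_0 hX) 1 ltr01.
exists d^-1; first by rewrite invr_gt0.
move=> f Xf; rewrite ler_pdivlMl//.
have X0 := bfs_norm_ge0 hX Xf; have Y0 := bfs_norm_ge0 hY (sXY _ Xf).
rewrite leNgt; apply/negP => lt.
have fY0 : 0 < fnorm Y f by rewrite -(pmulr_rgt0 _ d0) (le_lt_trans X0).
have /(hd _ (bfs_scale hX (fnorm Y f)^-1 Xf)) :
    fnorm X ((cst (fnorm Y f)^-1 \* f) \- cst 0) < d.
  rewrite sub0 (bfs_norm_scale hX)// ger0_norm ?invr_ge0//.
  by rewrite mulrC ltr_pdivrMr.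
rewrite sub0 (bfs_norm_scale hY) ?ger0_norm ?invr_ge0//; last exact: sXY.
by rewrite mulVf ?gt_eqF// ltxx.
Qed.

(** This is how a positive measure is exploited: an interval of positive length
cannot be contained in a null set. *)
Lemma ae01_exists (R : realType) (P : R -> Prop) (u v : R) :
  0 <= u -> u < v -> v <= 1 -> ae01 P -> exists2 x, u <= x <= v & P x.
Proof.
move=> u0 uv v1 [N [mN N0 PN]]; apply: contrapT => noP.
have sub : `[u, v]%classic `<=` N.
  move=> x /=; rewrite in_itv/= => /andP[ux xv]; apply: PN => /= Px.
  apply: noP; exists x; first by rewrite ux.
  by apply: Px; rewrite in_itv/= (le_trans u0 ux) (le_trans xv v1).
have : (lebm (`[u, v] : set (lebR R)) <= lebm N)%E.
  apply: le_measure => //; rewrite inE//.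
  by apply: measurable_lebR; exact: measurable_itv.
rewrite N0 => h.
have E : lebm (`[u, v] : set (lebR R)) = (v - u)%:E.
  by have := @lebesgue_measure_itv R `[u, v]; rewrite /= lte_fin uv.
by move: h; rewrite E lee_fin leNgt subr_gt0 uv.
Qed.

Lemma indic_Linf (R : realType) (u v : R) : carrier (Linf R) \1_(`[u, v]).
Proof.
split.
  have -> : \1_(`[u, v]) = (cst 1 : R -> R) \* \1_(`[u, v]).
    by apply/funext => x /=; rewrite mul1r.
  by apply: L0_indic; exact: measurable_cst.
rewrite /Linf_norm unlock; case: ifP => // _.
apply: (@le_lt_trans _ _ 1%E); last exact: ltry.
apply/ess_supP; apply: aeW => x /=; rewrite lee_fin !indic_itv -natrM.
by do 2 case: (_ <= _ <= _); rewrite /= ?normr1 ?normr0 ?ler01.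
Qed.

Lemma indic_norm_gt0 (R : realType) (X : fspace R) (u v : R) : is_bfs X ->
  0 <= u -> u < v -> v <= 1 -> carrier X \1_(`[u, v]) ->
  0 < fnorm X \1_(`[u, v]).
Proof.
move=> hX u0 uv v1 Xuv; rewrite lt_neqAle (bfs_norm_ge0 hX)// andbT eq_sym.
apply/eqP => /(bfs_norm_eq0 hX Xuv)/(ae01_exists _ _ _ _ u0 uv v1)[x uxv].
by rewrite indic_itv uxv; apply/eqP; rewrite oner_eq0.
Qed.

(** The level m of g on [u, v] is controlled by the norm of g in X, and it
dominates g on [a, b] in turn.  The constant K does not depend on g and m,
which is what yields equivalent norms rather than a mere equality of sets. *)
Lemma plateau_bound (R : realType) (X Y : fspace R) (a b u v c : R) :
  is_bfs X -> is_bfs Y -> 0 <= u -> u < v -> v <= 1 -> 0 <= c ->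
  carrier X \1_(`[u, v]) -> carrier Y \1_(`[a, b]) ->
  exists2 K, 0 <= K & forall (g : R -> R) m, carrier X g -> 0 <= m ->
    ae01 (fun x => u <= x <= v -> m <= g x) ->
    ae01 (fun x => a <= x <= b -> `|g x| <= c * m) ->
    carrier Y (g \* \1_(`[a, b])) /\
    fnorm Y (g \* \1_(`[a, b])) <= K * fnorm X g.
Proof.
move=> hX hY u0 uv v1 c0 Xuv Yab.
have nX := indic_norm_gt0 _ _ _ _ hX u0 uv v1 Xuv; have nY := bfs_norm_ge0 hY Yab.
(* from |g| <= c m and m <= ||g||_X / ||1_[u,v]||_X *)
exists (c * fnorm Y \1_(`[a, b]) / fnorm X \1_(`[u, v])).
  by rewrite divr_ge0 ?(ltW nX)// mulr_ge0.
move=> g m Xg m0 gm gcm.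
have lem : m * fnorm X \1_(`[u, v]) <= fnorm X g.
  rewrite -[m in leLHS]ger0_norm// -(bfs_norm_scale hX)//.
  have Xm := bfs_scale hX m Xuv; apply: (bfs_ideal hX (bfs_L0 hX Xm) Xg _).2.
  apply: ae01S gm => x _ /=; rewrite indic_itv; case: (_ <= _ <= _) => /= h.
    by rewrite mulr1 ger0_norm// (le_trans (h _))// ler_norm.
  by rewrite mulr0 normr0.
have cm0 : 0 <= c * m by rewrite mulr_ge0.
have [Yg le1] : carrier Y (g \* \1_(`[a, b])) /\
    fnorm Y (g \* \1_(`[a, b])) <= fnorm Y (cst (c * m) \* \1_(`[a, b])).
  apply: (bfs_ideal hY); [exact/L0_indic/(bfs_L0 hX)|exact: bfs_scale|].
  apply: ae01S gcm => x _ /=; rewrite indic_itv; case: (_ <= _ <= _) => /= h.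
    by rewrite !mulr1 (ger0_norm cm0) h.
  by rewrite !mulr0.
split=> //; apply: (le_trans le1).
rewrite (bfs_norm_scale hY)// (ger0_norm cm0) mulrAC [leRHS]mulrAC -[leRHS]mulrA.
by rewrite ler_wpM2l ?mulr_ge0// ler_pdivlMr.
Qed.

(** A function is dominated on [0, 1] by the sum of its three pieces; these
overlap at a and b, so that only an inequality holds there, which the ideal
property is able to use. *)
Lemma bfs_of_splice (R : realType) (X Y : fspace R) (a b K : R) (f : R -> R) :
  is_bfs X -> carrier Y `<=` carrier X -> 1 <= K ->
  (forall g, carrier Y g -> fnorm X g <= K * fnorm Y g) ->
  carrier (splice X Y a b) f ->
  carrier X f /\ fnorm X f <= K * fnorm (splice X Y a b) f.
Proof.
move=> hX YX K1 nK [Lf X1 Y2 X3] /=; have X2 := YX _ Y2.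
have X12 := bfs_add hX X1 X2; have X123 := bfs_add hX X12 X3.
have [|Xf fle] := bfs_ideal hX Lf X123.
  apply: (@ae01S _ (fun=> True)); last exact: ae01W.
  move=> x /andP[x0 x1] _ /=.
  rewrite !indic_itv x0 x1 /= andbT -!mulrDr -!natrD normrM ler_peMr//.
  rewrite normr_nat ler1n.
  have [//|xa] := leP x a; rewrite (ltW xa) /=.
  by have [//|xb] := leP x b; rewrite (ltW xb).
split=> //; apply: (le_trans fle).
apply: (le_trans (bfs_norm_add hX X12 X3)).
have := bfs_norm_add hX X1 X2; have := nK _ Y2.
have := bfs_norm_ge0 hX X1; have := bfs_norm_ge0 hX X3.
nra.
Qed.

Lemma splice_of_bfs (R : realType) (X Y : fspace R) (a b K : R) (g : R -> R) :
  is_bfs X -> carrier X g -> carrier Y (g \* \1_(`[a, b])) ->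
  fnorm Y (g \* \1_(`[a, b])) <= K * fnorm X g ->
  carrier (splice X Y a b) g /\
  fnorm (splice X Y a b) g <= (K + 2) * fnorm X g.
Proof.
move=> hX Xg Yg le; have [X1 l1] := bfs_indic hX 0 a Xg.
have [X3 l3] := bfs_indic hX b 1 Xg.
split; first by split=> //; exact: bfs_L0 hX _ Xg.
by rewrite /=; lra.
Qed.

(** The only property of T that matters: T|f| has a level m that it exceeds on
an outer interval and that bounds it, up to a fixed factor, on [a, b].  The
level may a priori be infinite; it is finite as soon as T|f| is finite at one
point of [u, v]. *)
Lemma opspace_splice (R : realType) (T : (R -> R) -> R -> \bar R)
    (X Y : fspace R) (a b u v c : R) :
  is_bfs X -> is_bfs Y -> embeds Y X -> carrier Y \1_(`[a, b]) ->
  carrier X \1_(`[u, v]) -> 0 <= u -> u < v -> v <= 1 -> 0 <= c ->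
  (forall f : R -> R, exists m : \bar R, [/\ (0 <= m)%E,
    forall x, u <= x <= v -> (m <= T (fun t => `|f t|%R) x)%E &
    forall x, a <= x <= b -> (0 <= T (fun t => `|f t|%R) x <= c%:E * m)%E]) ->
  equal_equiv (opspace T (splice X Y a b)) (opspace T X).
Proof.
move=> hX hY hYX Yab Xuv u0 uv v1 c0 hT.
have [K0 K00 nK0] := embeds_bounded _ _ _ hY hX hYX.
have [K' K'0 plat] := plateau_bound _ _ _ _ _ _ _ _ hX hY u0 uv v1 c0 Xuv Yab.
(* the outer pieces need no constant beyond 1, the middle one needs K0 *)
pose K := K0 + 1.
have ZX g : carrier (splice X Y a b) g ->
    carrier X g /\ fnorm X g <= K * fnorm (splice X Y a b) g.
  apply: bfs_of_splice => //; [exact: hYX.1|by rewrite /K; lra|move=> h Yh].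
  have := nK0 _ Yh; have := bfs_norm_ge0 hY Yh; rewrite /K; lra.
have XZ f : carrier (opspace T X) f -> carrier (opspace T (splice X Y a b)) f /\
    fnorm (opspace T (splice X Y a b)) f <= (K' + 2) * fnorm (opspace T X) f.
  move=> /= [Lf fin Xg]; have [m [m0 mT Tm]] := hT f.
  have fm : m \is a fin_num.
    have [x /mT mx Tx] := ae01_exists _ _ _ _ u0 uv v1 fin.
    by rewrite ge0_fin_numE// (le_lt_trans mx)// ltey_eq Tx.
  have [|||Yg le] := plat _ (fine m) Xg.
  - exact: fine_ge0.
  - apply: ae01S fin => x _ Tx /mT mx.
    by rewrite /= fine_le.
  - apply: ae01S fin => x _ Tx /Tm /andP[T0 Tcm].
    rewrite /= ger0_norm ?fine_ge0//.
    by rewrite -lee_fin EFinM !fineK.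
  by have [] := splice_of_bfs _ _ _ _ _ _ _ hX Xg Yg le.
split.
  apply/seteqP; split=> f; last by move=> /XZ[].
  by move=> [Lf fin /ZX[Xg _]].
exists K^-1, (K' + 2); have Kp : 0 < K by rewrite /K; lra.
split; [by rewrite invr_gt0|lra|move=> f [Lf fin Zg]].
have [Xg le] := ZX _ Zg.
by rewrite ler_pdivrMl//= le /=; apply: (XZ f _).2.
Qed.

Lemma Cesaro_plateau (R : realType) (a b : R) (f : R -> R) :
  0 < a -> 0 < b -> exists m : \bar R, [/\ (0 <= m)%E,
    forall x, b <= x <= 1 -> (m <= Cesaro_op (fun t => `|f t|%R) x)%E &
    forall x, a <= x <= b ->
      (0 <= Cesaro_op (fun t => `|f t|%R) x <= (a^-1)%:E * m)%E].
Proof.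
move=> a0 b0; set I := fun x : R => (\int[lebm]_(t in (`[0%R, x] : set (lebR R))) (`|f t|)%:E)%E.
have I0 x : (0 <= I x)%E by apply: integral_ge0 => t _; rewrite lee_fin.
have mono (x y : R) : x <= y -> (I x <= I y)%E.
  move=> xy; apply: ge0_integral_le_subset => [t _|t]; first by rewrite lee_fin.
  by rewrite /= !in_itv/= => /andP[-> /le_trans]; apply.
exists (I b); split=> // x /andP[h1 h2]; rewrite /Cesaro_op -/(I x).
  have x0 : 0 < x by apply: lt_le_trans h1.
  rewrite -[leLHS]mul1e; apply: lee_pmul => //; last exact: mono.
  by rewrite lee_fin invf_ge1.
have x0 := lt_le_trans a0 h1.
rewrite mule_ge0 ?lee_fin ?invr_ge0 ?(ltW x0)//=.
apply: lee_pmul => //; [by rewrite lee_fin invr_ge0 ltW| |exact: mono].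
by rewrite lee_fin lef_pV2.
Qed.

Lemma Copson_plateau (R : realType) (a b : R) (f : R -> R) :
  0 < a -> exists m : \bar R, [/\ (0 <= m)%E,
    forall x, 0 <= x <= a -> (m <= Copson_op (fun t => `|f t|%R) x)%E &
    forall x, a <= x <= b -> (0 <= Copson_op (fun t => `|f t|%R) x <= 1%:E * m)%E].
Proof.
move=> a0; set F := (fun t : lebR R => (`|f t| / t)%:E).
have F0 (x t : R) : 0 <= x -> `[x, 1]%classic t -> (0 <= F t)%E.
  move=> x0; rewrite /= in_itv/= => /andP[xt _].
  by rewrite lee_fin divr_ge0// (le_trans x0).
have mono (x y : R) : 0 <= x -> x <= y ->
    (Copson_op (fun t => `|f t|%R) y <= Copson_op (fun t => `|f t|%R) x)%E.
  move=> x0 xy; apply: ge0_integral_le_subset => t; first exact: F0.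
  by rewrite /= !in_itv/= => /andP[yt ->]; rewrite (le_trans xy).
have pos (x : R) : 0 <= x -> (0 <= Copson_op (fun t => `|f t|%R) x)%E.
  by move=> x0; apply: integral_ge0 => t; exact: F0.
exists (Copson_op (fun t => `|f t|) a); split.
- exact/pos/ltW.
- by move=> x /andP[x0 xa]; exact: mono.
- move=> x /andP[ax _]; rewrite mul1e pos ?mono//; first exact: ltW.
  exact: le_trans (ltW a0) ax.
Qed.

Theorem lemma6p2 (R : realType) (T : (R -> R) -> R -> \bar R)
    (hT : T = @Cesaro_op R \/ T = @Copson_op R)
    (X Y : fspace R) (hX : is_bfs X) (hY : is_bfs Y)
    (hLY : embeds (Linf R) Y) (hYX : embeds Y X)
    (a b : R) (ha : 0 < a) (hab : a < b) (hb : b < 1) :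
  equal_equiv (opspace T (splice X Y a b)) (opspace T X).
Proof.
have Yind u v : carrier Y \1_(`[u, v]) by apply: hLY.1; exact: indic_Linf.
have Xind u v : carrier X \1_(`[u, v]) by exact: hYX.1.
have b0 := lt_trans ha hab; have a1 := lt_trans hab hb.
case: hT => ->.
- apply: (@opspace_splice _ _ _ _ _ _ b 1 a^-1) => //; [exact: ltW| |].
    by rewrite invr_ge0 ltW.
  by move=> f; exact: Cesaro_plateau.
- apply: (@opspace_splice _ _ _ _ _ _ 0 a 1) => //; [exact: ltW|].
  by move=> f; exact: Copson_plateau.
Qed.
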